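(* Suppose $t_1,t_2,\ldots,t_d\in\mathbb{Z}_{\ge 2}$ are pairwise coprime (with $d \geq 1$), let $L=t_1t_2\cdots t_d$, and let $S=\langle L/t_1,\ldots,L/t_d\rangle$. If $k\in\mathbb{Z}_{\ge 0}$, then $\Delta_{kL}$ contains exactly those faces $F\subseteq[d]$ satisfying $|F|\le k$. Further, $\chi(\Delta_{kL})=(-1)^k\binom{d-1}{k}$, which is zero precisely when $k\ge d$.
   Context: For positive integers $n_1,\dots,n_d$, $\langle n_1,\ldots,n_d\rangle=\{\alpha_1n_1+\cdots+\alpha_dn_d:\alpha_i\in\mathbb{Z}_{\ge 0}\}$. Write $[d]=\{1,\ldots,d\}$, and for $F\subseteq[d]$ write $n_F=\sum_{i\in F}n_i$; here $n_i=L/t_i$. For a numerical semigroup $S=\langle n_1,\ldots,n_d\rangle$ with minimal generators $n_1,\ldots,n_d$ and $m\in S$, the squarefree divisor complex of $m$ is the simplicial complex $\Delta_m=\{F\subseteq[d]:m-n_F\in S\}$. The Euler characteristic of a simplicial complex $\Delta$ is $\chi(\Delta)=\sum_{F\in\Delta}(-1)^{|F|}$, where the sum includes the empty face. *)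

(* Defs.v *)
From mathcomp Require Import all_boot all_order all_algebra.
From mathcomp Require Import boolp classical_sets.

Set Implicit Arguments.
Unset Strict Implicit.
Unset Printing Implicit Defensive.

Import Order.TTheory GRing.Theory Num.Theory.

Local Open Scope ring_scope.

(* As a set of integers, so that [m - n_F \in S] is tested with the genuine
   subtraction rather than the truncated one of [nat]. *)
Definition semigroup_gen (d : nat) (n : 'I_d -> nat) : set int :=
  [set m : int | exists a : 'I_d -> nat, m = (\sum_(i < d) a i * n i)%N%:Z]%classic.

Definition sqfree_div_complex (d : nat) (n : 'I_d -> nat) (m : nat) :
    {set {set 'I_d}} :=
  [set F : {set 'I_d} | m%:Z - (\sum_(i in F) n i)%N%:Z \in semigroup_gen n]%SET.

(* Sums over all faces, the empty one included. *)
Definition euler_char (d : nat) (Delta : {set {set 'I_d}}) : int :=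
  \sum_(F in Delta) (-1) ^+ #|F|.

Lemma sqfree_div_complex_down_closed (d : nat) (n : 'I_d -> nat) (m : nat)
    (F G : {set 'I_d}) :
  G \subset F -> F \in sqfree_div_complex n m -> G \in sqfree_div_complex n m.
Proof.
move=> sGF; rewrite !inE => -[a Ha].
exists (fun i => a i + (i \in F :\: G)%SET)%N.
have -> : (\sum_(i < d) (a i + (i \in F :\: G)%SET) * n i
    = \sum_(i < d) a i * n i + \sum_(i in (F :\: G)%SET) n i)%N.
  rewrite [X in (_ + X)%N]big_mkcond -big_split; apply: eq_bigr => i _ /=.
  by rewrite mulnDl; case: (i \in _); rewrite ?mul1n ?mul0n.
rewrite PoszD -Ha (finset.big_setID (A := F) G) /= (finset.setIidPr sGF) PoszD.
by rewrite opprD addrA addrNK.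
Qed.

(* Main.v *)
Require Import Defs.
From mathcomp Require Import all_boot all_order all_algebra.
From mathcomp Require Import boolp classical_sets.

(** A set [F] is a face of the divisor complex of [m] exactly when some
    factorization [m = \sum_i b i * n i] has a support that contains [F]
    ([mem_sqfree_div_complexP]).  For [n i = L / t i] every such factorization
    of [k * L] has a rigid shape: modulo [t i] all the terms but the [i]-th
    vanish, and [n i] is a unit, so [t i] divides [b i]; writing
    [b i = c i * t i] gives [k = \sum_i c i], with [c i > 0] on [F], whence
    [#|F| <= k] ([card_face_le]).  Conversely, since [t i * n i = L] for every
    [i], a set of at most [k] indices supports the factorization that spends
    one [L] on each of its elements and all the others on a single index
    ([face_of_card_le]).

    So the complex of [k * L] is the [(k-1)]-skeleton of the full simplex, and
    its Euler characteristic is the truncated alternating sum of the ['C(d, j)]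
    for [j <= k], which telescopes by Pascal's rule
    ([sum_sign_card_le]). *)

Set Implicit Arguments.
Unset Strict Implicit.
Unset Printing Implicit Defensive.

Import Order.TTheory GRing.Theory Num.Theory.

Local Open Scope ring_scope.

(** Moving [n_F] to the other side of [m - n_F \in S] turns the coefficients
    [a i] into [a i + 1] on [F]; this removes the integer subtraction. *)
Lemma mem_sqfree_div_complexP (d : nat) (n : 'I_d -> nat) (m : nat)
    (F : {set 'I_d}) :
  F \in sqfree_div_complex n m <->
  exists2 b : 'I_d -> nat, forall i, i \in F -> (0 < b i)%N
    & m = (\sum_(i < d) b i * n i)%N.
Proof.
have sumF (a : 'I_d -> nat) : (\sum_(i < d) (a i + (i \in F)) * n i
    = \sum_(i < d) a i * n i + \sum_(i in F) n i)%N.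
  rewrite [X in (_ + X)%N]big_mkcond -big_split; apply: eq_bigr => i _ /=.
  by rewrite mulnDl; case: (i \in F); rewrite ?mul1n ?mul0n.
rewrite !inE; split=> [[a Ha] | [b b_gt0 ->]].
  exists (fun i => a i + (i \in F))%N => [i ->|]; first by rewrite addn1.
  by apply/eqP; rewrite sumF -eqz_nat PoszD -Ha subrK.
exists (fun i => b i - (i \in F))%N.
have -> : (\sum_(i < d) b i * n i
    = \sum_(i < d) ((b i - (i \in F)) + (i \in F)) * n i)%N.
  apply: eq_bigr => i _; rewrite subnK //.
  by case: (boolP (i \in F)) => // /b_gt0.
by rewrite sumF PoszD addrK.
Qed.

Section CoprimeProduct.

Variables (d : nat) (t : 'I_d -> nat).
Hypothesis t_gt0 : forall i, (0 < t i)%N.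

Let L := (\prod_(i < d) t i)%N.
Let n (i : 'I_d) := (L %/ t i)%N.

Lemma prod_divn_factor i : n i = (\prod_(j < d | j != i) t j)%N.
Proof. by rewrite /n /L (bigD1 i) //= mulKn. Qed.

Lemma muln_prod_divn i : (t i * n i)%N = L.
Proof. by rewrite prod_divn_factor /L [RHS](bigD1 i). Qed.

Lemma face_of_card_le (k : nat) (F : {set 'I_d}) : (0 < d)%N ->
  (#|F| <= k)%N -> F \in sqfree_div_complex n (k * L).
Proof.
move=> d_gt0 leFk; apply/mem_sqfree_div_complexP.
pose i0 := Ordinal d_gt0.
(* Each element of [F] receives one copy of [L = t i * n i]; the remaining
   [k - #|F|] copies all go to [i0]. *)
exists (fun i => ((i \in F) + (i == i0) * (k - #|F|)) * t i)%N => [i ->|].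
  by rewrite muln_gt0 t_gt0.
under eq_bigr => i _ do rewrite -mulnA muln_prod_divn.
rewrite -big_distrl /= big_split /= -big_distrl /=; congr (_ * _)%N.
rewrite -[X in (X + _)%N]big_mkcond /= sum1_card.
by rewrite -[X in (X * _)%N]big_mkcond /= big_pred1_eq mul1n subnKC.
Qed.

Hypothesis t_coprime : forall i j, i != j -> coprime (t i) (t j).

(** Modulo [t i] the equation reduces to [b i * n i = 0], because [t i] divides
    both [L] and every [n j] with [j != i]; and [n i], a product of numbers
    coprime to [t i], can be cancelled. *)
Lemma dvdn_factorization (k : nat) (b : 'I_d -> nat) :
  (k * L = \sum_(j < d) b j * n j)%N -> forall i, (t i %| b i)%N.
Proof.
move=> eq_kL i.
have co_tn : coprime (t i) (n i).
  rewrite prod_divn_factor.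
  elim/big_rec: _ => [|j p ne_ji co_tp]; first exact: coprimen1.
  by rewrite coprimeMr co_tp andbT t_coprime // eq_sym.
have dvd_tn j : j != i -> (t i %| n j)%N.
  by move=> ne_ji; rewrite prod_divn_factor (bigD1 i) 1?eq_sym //= dvdn_mulr.
have dvd_rest : (t i %| \sum_(j < d | j != i) b j * n j)%N.
  by apply: dvdn_sum => j /dvd_tn; apply: dvdn_mull.
rewrite -(Gauss_dvdl _ co_tn) -(dvdn_addl _ dvd_rest).
move: eq_kL; rewrite (bigD1 i) //= => <-.
by rewrite -(muln_prod_divn i) dvdn_mull // dvdn_mulr.
Qed.

(** Divisibility turns [b i * n i] into [(b i %/ t i) * L], so the quotients
    [b i %/ t i] sum to [k], and those indexed by [F] are positive. *)
Lemma card_face_le (k : nat) (F : {set 'I_d}) :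
  F \in sqfree_div_complex n (k * L) -> (#|F| <= k)%N.
Proof.
move=> /mem_sqfree_div_complexP[b b_gt0 eq_kL].
have dvd_tb := dvdn_factorization eq_kL.
have L_gt0 : (0 < L)%N by rewrite prodn_gt0.
have -> : k = (\sum_(i < d) b i %/ t i)%N.
  apply/eqP; rewrite -(eqn_pmul2r L_gt0) eq_kL big_distrl /=; apply/eqP.
  by apply: eq_bigr => i _; rewrite -(muln_prod_divn i) mulnA divnK.
rewrite -sum1_card big_mkcond; apply: leq_sum => i _.
by case: ifP => // /b_gt0 bi_gt0; rewrite divn_gt0 // dvdn_leq.
Qed.

End CoprimeProduct.

(** The partial alternating sums of a row of Pascal's triangle, counted by
    subsets: going from [k] to [k.+1] adds [(-1) ^+ k.+1 * 'C(d.+1, k.+1)],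
    and Pascal's rule cancels the part ['C(d, k)] of it. *)
Lemma sum_sign_card_le (T : finType) (d k : nat) : #|T| = d.+1 ->
  \sum_(F : {set T} | (#|F| <= k)%N) (-1) ^+ #|F|
    = (-1) ^+ k * ('C(d, k))%:Z :> int.
Proof.
move=> cardT.
have level j : \sum_(F : {set T} | #|F| == j) (-1) ^+ #|F|
    = (-1) ^+ j * ('C(d.+1, j))%:Z :> int.
  rewrite (eq_bigr (fun=> (-1) ^+ j)) => [|F /eqP -> //].
  rewrite sumr_const -cardT -card_draws -natz mulr_natr; congr (_ *+ _).
  by apply: eq_card => F; rewrite inE.
elim: k => [|k IHk].
  by under eq_bigl => F do rewrite leqn0; rewrite level !bin0.
rewrite (bigID (fun F : {set T} => #|F| == k.+1)) /=.
have -> : \sum_(F : {set T} | (#|F| <= k.+1)%N && (#|F| != k.+1)) (-1) ^+ #|F|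
    = \sum_(F : {set T} | (#|F| <= k)%N) (-1) ^+ #|F| :> int.
  by apply: eq_bigl => F; rewrite andbC -ltn_neqAle ltnS.
have -> : \sum_(F : {set T} | (#|F| <= k.+1)%N && (#|F| == k.+1)) (-1) ^+ #|F|
    = \sum_(F : {set T} | #|F| == k.+1) (-1) ^+ #|F| :> int.
  by apply: eq_bigl => F; case: eqP => [->|]; rewrite ?leqnn ?andbF.
by rewrite level IHk binS PoszD mulrDr exprS !mulN1r !mulNr -addrA addNr addr0.
Qed.

Theorem theorem3p1 (d : nat) (t : 'I_d -> nat) (k : nat)
    (d_gt0 : (0 < d)%N)
    (t_ge2 : forall i, (2 <= t i)%N)
    (t_coprime : forall i j, i != j -> coprime (t i) (t j)) :
  let L := (\prod_(i < d) t i)%N in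
  let n := fun i : 'I_d => (L %/ t i)%N in
  let Delta := sqfree_div_complex n (k * L)%N in
  [/\ forall F : {set 'I_d}, F \in Delta <-> (#|F| <= k)%N,
      euler_char Delta = (-1) ^+ k * ('C(d - 1, k)%N)%:Z
    & euler_char Delta = 0 <-> (d <= k)%N].
Proof.
move=> L n Delta.
have t_gt0 i : (0 < t i)%N by apply: ltnW.
have facesE (F : {set 'I_d}) : F \in Delta <-> (#|F| <= k)%N.
  by split; [apply: card_face_le | apply: face_of_card_le].
have chiE : euler_char Delta = (-1) ^+ k * ('C(d - 1, k)%N)%:Z.
  rewrite -(@sum_sign_card_le 'I_d) ?card_ord ?subn1 ?prednK //.
  by apply: eq_bigl => F; apply/idP/idP => /facesE.
split=> //; rewrite chiE; apply: (iff_trans (rwP eqP)).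
rewrite mulf_eq0 signr_eq0 /= eqz_nat -leqn0 leqNgt bin_gt0 subn1.
by rewrite -ltnNge prednK.
Qed.
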